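(* Let $B\in\mathbb{C}^{n\times n}$ have Jordan canonical form $J=\mathrm{diag}(J_1,\dots,J_s)$, where, for $1\le k\le s$, $J_k\in\mathbb{C}^{n_k\times n_k}$ is the upper triangular Jordan block with all diagonal entries equal to $\mu_k$ and all entries of the first superdiagonal equal to $1$, for some positive integer $n_k$ (so $n_1+\dots+n_s=n$). Assume that for every $1\le k\le s$ there exists $\tilde\mu_k\in\mathbb{C}$ with $\mathrm{Re}(\tilde\mu_k)\ge 1$ and $\mu_k=\frac{m(\tilde\mu_k)}{m(\tilde\mu_k-1)}$, and that for all $1\le k_1,k_2\le s$ with $k_1\ne k_2$ and all positive integers $\ell$ one has $$\mu_{k_1}\neq\frac{m(\tilde\mu_{k_2}+\ell)}{m(\tilde\mu_{k_2}+\ell-1)} .$$ Then there exist $s$ formal solutions $C_1,\dots,C_s$ of $$z\,\partial_m y=By\qquad(\ast)$$ in the form of a Floquet formal power series. Moreover, assume that for every $1\le k\le s$ there exist functions $H_{m,1,\tilde\mu_k}(z)=z^{\tilde\mu_k}$ and $H_{m,p,\tilde\mu_k}$, $p\ge 2$, on some domain $U\subseteq\mathbb{C}$ with $0\in\overline{U}$ such that for all $p\ge 1$ $$z\,\partial_m(H_{m,p+1,\tilde\mu_k})(z)=\mu_k H_{m,p+1,\tilde\mu_k}(z)+H_{m,p,\tilde\mu_k}(z),\qquad z\in U .$$ Then there exist $n-s$ symbolic solutions of $(\ast)$: $C_{1,1},\dots,C_{1,n_1-1}$ associated to $C_1$, $\dots$, and $C_{s,1},\dots,C_{s,n_s-1}$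 associated to $C_s$. The symbolic matrix with these columns, $$z_m^{B}:=\big(C_1(z),C_{1,1}(z),\dots,C_{1,n_1-1}(z),\dots,C_s(z),C_{s,1}(z),\dots,C_{s,n_s-1}(z)\big),$$ is a symbolic solution of $(\ast)$.
   Context: Let $m:\{z\in\mathbb{C}:\mathrm{Re}(z)\ge 0\}\to\mathbb{C}$ be a function whose restriction to the nonnegative integers is a sequence of positive real numbers $(m(p))_{p\ge 0}$. Whenever a quotient of values of $m$ is used, its denominator is understood to be nonzero. For $\nu\in\mathbb{C}$ with $\mathrm{Re}(\nu)\ge 1$, the moment derivative $\partial_m$ is defined on $z^{\nu}\mathbb{C}[[z]]=\{\sum_{p\ge 0}a_pz^{\nu+p}:a_p\in\mathbb{C}\}$ by $$\partial_m\Big(\sum_{p\ge 0}a_pz^{p+\nu}\Big)=\sum_{p\ge 0}a_p\frac{m(p+\nu)}{m(p+\nu-1)}z^{p+\nu-1},$$ and acts componentwise on vectors and matrices. In the second part of the claim, $\partial_m$ is understood as a $\mathbb{C}$-linear operator extending this one to a vector space containing the functions $H_{m,p,\tilde\mu_k}$ (on which the displayed relations hold); ''symbolic solution'' means that the equation holds with respect to this linear extension. A matrix is a solution of $(\ast)$ if each of its columns is. A Floquet formal power series is one of the form $\sum_{p\ge 0}s_pz^{p+\mu}$ with $s_p\in\mathbb{C}^n$, $s_0\ne 0$. Meaning of ''associated to $C_k$'': write $B=PJP^{-1}$ and let $v_{k,1},\dots,v_{k,n_k}$ be the consecutive columns of $P$ corresponding to the block $J_k$ (so $Bv_{k,1}=\mu_kv_{k,1}$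 and $Bv_{k,i}=\mu_kv_{k,i}+v_{k,i-1}$ for $i\ge 2$). Then $C_k=z^{\tilde\mu_k}v_{k,1}$ and, for $1\le j\le n_k-1$, $$C_{k,j}=\sum_{i=1}^{j+1}H_{m,j+2-i,\tilde\mu_k}(z)\,v_{k,i}.$$ *)

(* Defs.v *)
(* The complex numbers are R[i] for R : realType, and R[i]^o
   is the same type seen as a normed space over itself *)
From HB Require Import structures.
From mathcomp Require Export all_boot all_order all_algebra.
From mathcomp Require Export all_classical all_reals all_analysis.
From mathcomp Require Export complex.
Export numFieldNormedType.Exports.
Import Order.TTheory GRing.Theory Num.Theory.

Set Implicit Arguments.
Unset Strict Implicit.
Unset Printing Implicit Defensive.

Local Open Scope classical_set_scope.
Local Open Scope ring_scope.

(* f : fseries R stands for the formal sum of the f la * z^la.  All the spaces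
   z^nu C[[z]] are subspaces of this single vector space (see zseries). *)
Notation fseries R := (R[i] -> R[i]^o).

Section FormalSeries.
Variable R : realType.
Implicit Types (nu la : R[i]) (a : nat -> R[i]) (f : fseries R).

(* \sum_(p >= 0) a_p z^(p + nu) *)
Definition zseries nu a : fseries R := fun la =>
  if pselect (exists p : nat, la = nu + p%:R) is left h
  then a (projT1 (cid h)) else 0.

(* z^nu C[[z]] *)
Definition zspace nu : set (fseries R) := range (zseries nu).

Definition zmul f : fseries R := fun la => f (la - 1).

Variable m : R[i] -> R[i].

(* All the quotients occurring in the moment derivative on z^nu C[[z]] are
   defined; m is only evaluated on the closed right half-plane there. *)
Definition dm_exponent nu : Prop :=
  1 <= complex.Re nu /\ forall p : nat, m (nu + p%:R - 1) != 0.

Definition dm_dom : set (fseries R) :=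
  [set f | exists2 nu, dm_exponent nu & zspace nu f].

(* The coefficient of z^la in the derivative comes from that of z^(la + 1);
   only the values on dm_dom are meaningful.  See dm_zseries below. *)
Definition dm f : fseries R := fun la => (m (la + 1) / m la) * f (la + 1).

Lemma zseriesE nu a (p : nat) : zseries nu a (nu + p%:R) = a p.
Proof.
rewrite /zseries; case: pselect => [h|[]]; last by exists p.
have /addrI e := projT2 (cid h).
by congr a; apply/eqP; rewrite -(eqr_nat R[i]) -e.
Qed.

Lemma zseries_out nu a la :
  (forall p : nat, la <> nu + p%:R) -> zseries nu a la = 0.
Proof.
move=> h; rewrite /zseries; case: pselect => // e.
by exfalso; case: e => p /h.
Qed.

Lemma dm_zseries nu a :
  dm (zseries nu a) = zseries (nu - 1)
    (fun p => a p * (m (p%:R + nu) / m (p%:R + nu - 1))).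
Proof.
apply/funext => la; rewrite /dm.
have [[p e]|h] := pselect (exists p : nat, la = (nu - 1) + p%:R).
  have e1 : la + 1 = nu + p%:R by rewrite e addrAC subrK.
  rewrite e1 {2}e !zseriesE mulrC; congr (_ * (m _ / m _)).
    by rewrite addrC.
  by rewrite e addrAC [nu + _]addrC.
rewrite [RHS]zseries_out => [|p e]; last by apply: h; exists p.
rewrite zseries_out ?mulr0// => p e; apply: h; exists p.
by rewrite addrAC -e addrK.
Qed.

Lemma zmul_zseries nu a : zmul (zseries nu a) = zseries (nu + 1) a.
Proof.
apply/funext => la; rewrite /zmul.
have [[p ->]|h] := pselect (exists p : nat, la = (nu + 1) + p%:R).
  by rewrite zseriesE addrAC addrK zseriesE.
rewrite [RHS]zseries_out => [|p e]; last by apply: h; exists p.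
rewrite zseries_out// => p e; apply: h; exists p.
by rewrite addrAC -e subrK.
Qed.

End FormalSeries.

Section Systems.
Variables (K : pzRingType) (E : lmodType K) (dom : set E) (z d : E -> E).
Variables (n : nat) (B : 'M[K]_n).

Definition solves (y : 'cV[E]_n) : Prop :=
  (forall r, dom (y r 0)) /\
  (forall r, z (d (y r 0)) = \sum_(l < n) B r l *: y l 0).

Definition solves_mx p (Y : 'M[E]_(n, p)) : Prop := forall c, solves (col c Y).

End Systems.

Section Floquet.
Variables (R : realType) (n : nat).

(* \sum_(p >= 0) s_p z^(p + nu) with vector coefficients *)
Definition zseries_col (nu : R[i]) (s : nat -> 'cV[R[i]]_n) :
    'cV[fseries R]_n :=
  \col_r zseries nu (fun p => s p r 0).

Definition zmonomial_col (nu : R[i]) (v : 'cV[R[i]]_n) : 'cV[fseries R]_n :=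
  zseries_col nu (fun p => if p == 0%N then v else 0).

Definition is_floquet (y : 'cV[fseries R]_n) : Prop :=
  exists nu s, s 0%N != 0 /\ y = zseries_col nu s.

Definition formal_solution (m : R[i] -> R[i]) (B : 'M[R[i]]_n)
    (y : 'cV[fseries R]_n) : Prop :=
  solves (dm_dom m) (@zmul R) (dm m) B y.

End Floquet.

Definition jordan_block (K : pzRingType) (n : nat) (mu : K) : 'M[K]_n :=
  \matrix_(i, j) (mu *+ (i == j) + (i.+1 == j :> nat)%:R).

(* With n = \sum_k nk k, v_(k, i) is the i-th (from 0) of the columns of P
   facing the k-th block. *)
Definition jcol (K : pzRingType) (s : nat) (nk : 'I_s -> nat)
    (P : 'M[K]_(\sum_k nk k)) (k : 'I_s) (i : 'I_(nk k)) :
    'cV[K]_(\sum_k nk k) :=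
  col (tagnat.Rank k i) P.

Section Powers.
Variable R : realType.

Definition cexp (w : R[i]) : R[i] :=
  ((expR (complex.Re w) * cos (complex.Im w))
   +i* (expR (complex.Re w) * sin (complex.Im w)))%C.

(* f is a determination of z^nu on U.  L picks logarithms pointwise; continuity
   of f makes the choices coherent.  This phrasing allows 0 \in U when nu is a
   positive integer, where no continuous logarithm exists. *)
Definition power_on (U : set R[i]^o) (nu : R[i]) (f : U -> R[i]^o) : Prop :=
  continuous f /\
  exists L : R[i] -> R[i], forall u : U, set_val u != 0 ->
    cexp (L (set_val u)) = set_val u /\ f u = cexp (nu * L (set_val u)).

End Powers.

(* An extension of the moment derivative.  The ambient space amb contains both
   the formal series and the functions on U, each faithfully, and ext_d is a
   linear operator defined on the subspace ext_dom of amb.  Nothing forces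
   ext_dom to contain any function on U. *)
Record dm_extension (R : realType) (m : R[i] -> R[i]) (U : set R[i]^o) :=
    DmExtension {
  amb : lmodType R[i];
  of_series : {linear fseries R -> amb};
  of_fun : {linear (U -> R[i]^o) -> amb};
  of_series_inj : injective of_series;
  of_fun_inj : injective of_fun;
  ext_z : {linear amb -> amb};
  ext_z_series : forall f, ext_z (of_series f) = of_series (zmul f);
  ext_z_fun : forall h : U -> R[i]^o,
    ext_z (of_fun h) = of_fun (fun u => set_val u * h u);
  ext_dom : set amb;
  ext_d : amb -> amb;
  ext_dom_linear : forall (c : R[i]) x y,
    ext_dom x -> ext_dom y -> ext_dom (c *: x + y);
  ext_d_linear : forall (c : R[i]) x y,
    ext_dom x -> ext_dom y -> ext_d (c *: x + y) = c *: ext_d x + ext_d y;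
  ext_dom_series : forall f, dm_dom m f -> ext_dom (of_series f);
  ext_d_series : forall f, dm_dom m f ->
    ext_d (of_series f) = of_series (dm m f)
}.

Arguments amb {R m U} _.
Arguments of_series {R m U} _.
Arguments of_fun {R m U} _.
Arguments ext_z {R m U} _.
Arguments ext_dom {R m U} _.
Arguments ext_d {R m U} _.

Section Symbolic.
Variables (R : realType) (m : R[i] -> R[i]) (U : set R[i]^o).
Variable (X : dm_extension m U).

(* h p (p >= 1) is the function H_(m, p, nu).  The formal monomial z^nu and the
   function h 1 are the same symbolic object; in the last clause g is the
   function d_m (h p.+1). *)
Definition H_family (mu nu : R[i]) (h : nat -> U -> R[i]^o) : Prop :=
  [/\ power_on nu (h 1%N),
      of_fun X (h 1%N) = of_series X (zseries nu (fun p => (p == 0%N)%:R)),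
      forall p : nat, (0 < p)%N -> ext_dom X (of_fun X (h p)) &
      forall p : nat, (0 < p)%N ->
        exists2 g : U -> R[i]^o, ext_d X (of_fun X (h p.+1)) = of_fun X g &
          forall u : U, set_val u * g u = mu * h p.+1 u + h p u].

Variable n : nat.

Definition series_col (y : 'cV[fseries R]_n) : 'cV[amb X]_n :=
  \col_r of_series X (y r 0).

Definition fun_col (y : U -> 'cV[R[i]]_n) : 'cV[amb X]_n :=
  \col_r of_fun X (fun u => y u r 0).

Definition symbolic_solution (B : 'M[R[i]]_n) (y : 'cV[amb X]_n) : Prop :=
  solves (ext_dom X) (ext_z X) (ext_d X) B y.

Definition symbolic_solution_mx (B : 'M[R[i]]_n) p
    (Y : 'M[amb X]_(n, p)) : Prop :=
  solves_mx (ext_dom X) (ext_z X) (ext_d X) B Y.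

(* The n x nk block (C, D_1, ..., D_(nk - 1)) *)
Definition symbolic_block (nk : nat) (C : 'cV[fseries R]_n)
    (D : 'I_nk -> U -> 'cV[R[i]]_n) : 'M[amb X]_(n, nk) :=
  \matrix_(r, j) (if j == 0%N :> nat then series_col C r 0
                  else fun_col (D j) r 0).

End Symbolic.

(* Main.v *)
Require Import Defs.
Import Order.TTheory GRing.Theory Num.Theory.

Set Implicit Arguments.
Unset Strict Implicit.
Unset Printing Implicit Defensive.

Local Open Scope classical_set_scope.
Local Open Scope ring_scope.

(** Two chains are convolved for each Jordan block.  The columns v_0, v_1, ... of P facing
    the Jordan block of mu satisfy B v_i = mu v_i + v_(i-1), and the functions
    w_1 = z^nu, w_2, ... satisfy z d w_p = mu w_p + w_(p-1), with the
    conventions v_(-1) = 0 and w_p = 0 for p <= 0.  In the convolution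
    y_j = \sum_i w_(j+1-i) v_i, the operators z d and B both act as mu plus a
    shift by one step, and lowering the index of w or that of v by one gives
    the same sum \sum_i w_(j-i) v_i; hence z d y_j = B y_j
    ([jordan_convolution_solves]).

    For j = 0 the convolution is z^nu v_0, which is a formal power series, and
    the equation reduces to z d z^nu = mu z^nu, that is, to
    mu = m nu / m (nu - 1) ([zmul_dm_monomial]).  Since an extension of the
    moment derivative identifies the formal monomial with the function w_1,
    the columns C_k and C_(k,j) of the symbolic matrix are all instances of
    one convolution ([symbolic_solution_convolution]). *)

(** * Linear operators defined on a subspace *)

Section PartialLinear.
Variables (K : pzRingType) (E : lmodType K) (dom : set E) (d : E -> E).
Hypothesis dom_linear : forall (c : K) x y,
  dom x -> dom y -> dom (c *: x + y).
Hypothesis d_linear : forall (c : K) x y,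
  dom x -> dom y -> d (c *: x + y) = c *: d x + d y.

(** A set closed under linear combinations may be empty, hence the premise;
    the value at 0 comes from writing 0 as - x + x. *)
Lemma partial_linear0 x : dom x -> dom 0 /\ d 0 = 0.
Proof.
move=> dx; have e : 0 = (-1) *: x + x by rewrite scaleN1r addNr.
split; first by rewrite e; exact: dom_linear.
by rewrite [X in d X]e d_linear// scaleN1r addNr.
Qed.

Lemma partial_linear_sum n (c : 'I_n -> K) (x : 'I_n -> E) :
  dom 0 -> d 0 = 0 -> (forall i, dom (x i)) ->
  dom (\sum_i c i *: x i) /\ d (\sum_i c i *: x i) = \sum_i c i *: d (x i).
Proof.
move=> dom0 d0 domx; elim/big_ind2: _ => // [x1 x2 y1 y2 [Dx dx] [Dy dy]|i _].
  rewrite -[x2]scale1r; split; first exact: dom_linear.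
  by rewrite d_linear// dx dy scale1r.
split; first by rewrite -[_ *: _]addr0; exact: dom_linear.
by rewrite -[c i *: x i]addr0 d_linear// d0 addr0.
Qed.

End PartialLinear.

(** * Convolution of a Jordan chain with a chain of functions *)

(** Right multiplication by a Jordan block shifts columns: the coefficient of
    each [w q.+1] moves down to [w q].  The column pushed out at the right end
    is paired with [w 0], because the convolution starts at an index j < nk. *)
Lemma jordan_block_convolution (K : pzRingType) (E : lmodType K) n nk
    (mu : K) (V : 'M[K]_(n, nk)) (w : nat -> E) (j : 'I_nk) r :
  w 0%N = 0 ->
  \sum_i (V *m jordan_block nk mu) r i *: w (j.+1 - i)%N =
  \sum_i V r i *: (mu *: w (j.+1 - i)%N + w (j - i)%N).
Proof.
move=> w0; under eq_bigr => i _ do rewrite mxE scaler_suml.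
rewrite exchange_big /=; apply: eq_bigr => i _.
under eq_bigr => i' _ do rewrite mxE -scalerA.
rewrite -scaler_sumr; congr (_ *: _).
under eq_bigr => i' _ do rewrite scalerDl.
rewrite big_split /=; congr (_ + _).
  rewrite (bigD1 i)//= eqxx mulr1n big1 ?addr0// => i' /negPf ni.
  by rewrite eq_sym ni mulr0n scale0r.
have [ltin|geni] := ltnP i.+1 nk.
  rewrite (bigD1 (Ordinal ltin))//= eqxx scale1r subSS big1 ?addr0// => i' ni.
  rewrite (_ : (_ == _) = false) ?scale0r//.
  by apply: contra_neqF ni => /eqP e; apply/val_inj.
rewrite big1 => [|i' _]; last first.
  by rewrite gtn_eqF ?scale0r// (leq_trans (ltn_ord i')).
have /eqP-> : (j - i)%N == 0%N by rewrite subn_eq0 -ltnS (leq_trans _ geni).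
by rewrite w0.
Qed.

(** On the one side z d lowers the index of [w] and fixes the coefficients, on
    the other side B acts on the coefficients through the Jordan block;
    [jordan_block_convolution] equates the two. *)
Lemma jordan_convolution_solves (K : pzRingType) (E : lmodType K)
    (dom : set E) (z : {linear E -> E}) (d : E -> E) n nk
    (mu : K) (B : 'M[K]_n) (V : 'M[K]_(n, nk)) (w : nat -> E) (j : 'I_nk) :
  (forall (c : K) x y, dom x -> dom y -> dom (c *: x + y)) ->
  (forall (c : K) x y, dom x -> dom y -> d (c *: x + y) = c *: d x + d y) ->
  B *m V = V *m jordan_block nk mu ->
  w 0%N = 0 -> (forall p, dom (w p.+1)) ->
  (forall p, z (d (w p.+1)) = mu *: w p.+1 + w p) ->
  solves dom z d B (\col_r \sum_i V r i *: w (j.+1 - i)%N).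
Proof.
move=> dom_linear d_linear BV w0 domw dw.
have [dom0 d0] := partial_linear0 dom_linear d_linear (domw 0%N).
have domW p : dom (w p) by case: p => [|p]; rewrite ?w0.
have lin r := partial_linear_sum dom_linear d_linear (fun i => V r i) dom0 d0
  (fun i : 'I_nk => domW (j.+1 - i)%N).
split=> r; rewrite mxE; have [// Dr dr] := lin r.
rewrite dr linear_sum.
transitivity (\sum_i (V *m jordan_block nk mu) r i *: w (j.+1 - i)%N).
  rewrite jordan_block_convolution//; apply: eq_bigr => i _.
  rewrite linearZ; congr (_ *: _).
  have [leij|ltji] := leqP i j; first by rewrite subSn.
  (* Beyond the start of the chain both truncated subtractions give w 0. *)
  have /eqP-> : (j.+1 - i)%N == 0%N by rewrite subn_eq0.
  have /eqP-> : (j - i)%N == 0%N by rewrite subn_eq0 ltnW.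
  by rewrite w0 d0 linear0 scaler0 addr0.
rewrite -BV; under eq_bigr => i _ do rewrite mxE scaler_suml.
rewrite exchange_big /=; apply: eq_bigr => l _; rewrite mxE scaler_sumr.
by apply: eq_bigr => i _; rewrite scalerA.
Qed.

(** * The columns of the change of basis *)

Lemma jcolE (K : pzRingType) s (nk : 'I_s -> nat)
    (P : 'M[K]_(\sum_k nk k)) k (i : 'I_(nk k)) :
  jcol P i = col i (submxrow P k).
Proof. by apply/matrixP => r c; rewrite !mxE. Qed.

Lemma mul_submxrow_jordan (K : comUnitRingType) s (nk : 'I_s -> nat)
    (mu : 'I_s -> K) (B P : 'M[K]_(\sum_k nk k)) k :
  P \in unitmx ->
  B = P *m (\mxdiag_k jordan_block (nk k) (mu k)) *m invmx P ->
  B *m submxrow P k = submxrow P k *m jordan_block (nk k) (mu k).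
Proof.
move=> Pu ->; rewrite mul_submxrow mulmxKV//.
by rewrite -[X in X *m _]submxrowK mul_mxrow_mxdiag mxrowK.
Qed.

Lemma col_mul_jordan_block (K : comPzRingType) n nk (mu : K)
    (V : 'M[K]_(n, nk)) (nk_gt0 : (0 < nk)%N) :
  col (Ordinal nk_gt0) (V *m jordan_block nk mu) =
  mu *: col (Ordinal nk_gt0) V.
Proof.
apply/matrixP => r c; rewrite !mxE (bigD1 (Ordinal nk_gt0))//= big1 => [|i ni].
  by rewrite mxE eqxx !addr0 mulrC.
by rewrite mxE (negPf ni) addr0 mulr0.
Qed.

Lemma jcol_neq0 (K : comUnitRingType) s (nk : 'I_s -> nat)
    (P : 'M[K]_(\sum_k nk k)) k (i : 'I_(nk k)) :
  P \in unitmx -> jcol P i != 0.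
Proof.
move=> Pu; apply/eqP => /(congr1 (mulmx (invmx P))).
rewrite mulmx0 /jcol colE mulKmx// => /matrixP /(_ (tagnat.Rank k i) 0).
by rewrite !mxE !eqxx => /eqP; rewrite oner_eq0.
Qed.

(** * Formal monomials *)

Section Monomials.
Variable R : realType.
Implicit Types (nu la c : R[i]) (m : R[i] -> R[i]).

Definition monomial nu : fseries R := zseries nu (fun p => (p == 0%N)%:R).

Lemma monomialE nu la : monomial nu la = (la == nu)%:R.
Proof.
have [->|ne] := eqVneq la nu.
  by have := zseriesE nu (fun p => (p == 0%N)%:R) 0; rewrite addr0.
have [[p e]|h] := pselect (exists p : nat, la = nu + p%:R).
  rewrite e /monomial zseriesE; case: p e => // e.
  by move: ne; rewrite e addr0 eqxx.
by rewrite /monomial zseries_out// => p e; apply: h; exists p.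
Qed.

Lemma fseries_scaleE c (f : fseries R) la : (c *: f) la = c * f la.
Proof. by []. Qed.

Lemma zseriesZ nu c (a : nat -> R[i]) :
  zseries nu (fun p => c * a p) = c *: zseries nu a.
Proof.
apply/funext => la; rewrite fseries_scaleE /zseries.
by case: pselect => // _; rewrite mulr0.
Qed.

(** The operator z d is diagonal on formal series, with eigenvalue
    m la / m (la - 1) on z^la. *)
Lemma zmul_dmE m (f : fseries R) la :
  zmul (dm m f) la = m la / m (la - 1) * f la.
Proof. by rewrite /zmul /dm subrK. Qed.

Lemma zmul_dm_monomial m nu c :
  zmul (dm m (c *: monomial nu)) = (m nu / m (nu - 1)) *: (c *: monomial nu).
Proof.
apply/funext => la; rewrite zmul_dmE !fseries_scaleE.
by rewrite monomialE; have [->//|_] := eqVneq la nu; rewrite !mulr0.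
Qed.

Lemma dm_dom_monomial m nu c :
  dm_exponent m nu -> dm_dom m (c *: monomial nu).
Proof.
by move=> hnu; exists nu => //; eexists; last exact: zseriesZ.
Qed.

Lemma zmonomial_colE n nu (v : 'cV[R[i]]_n) r :
  zmonomial_col nu v r 0 = v r 0 *: monomial nu.
Proof.
rewrite mxE -zseriesZ; congr zseries; apply/funext => p.
by case: eqP => _; rewrite ?mulr1// mxE mulr0.
Qed.

Lemma is_floquet_zmonomial n nu (v : 'cV[R[i]]_n) :
  v != 0 -> is_floquet (zmonomial_col nu v).
Proof. by move=> v0; exists nu; eexists; split; last reflexivity. Qed.

Lemma formal_solution_eigenvector n m (B : 'M[R[i]]_n) nu (v : 'cV_n) :
  dm_exponent m nu -> B *m v = (m nu / m (nu - 1)) *: v ->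
  formal_solution m B (zmonomial_col nu v).
Proof.
move=> hnu Bv; split=> r; rewrite zmonomial_colE; first exact: dm_dom_monomial.
under eq_bigr => l _ do rewrite zmonomial_colE scalerA.
rewrite -scaler_suml zmul_dm_monomial scalerA; congr (_ *: _).
by move/matrixP/(_ r 0): Bv; rewrite !mxE => <-.
Qed.

End Monomials.

(** * Columns of the symbolic matrix *)

(** The chain w_1 = H_1, w_2 = H_2, ... of an [H_family], preceded by w_0 = 0
    so that its first link is the eigenvector equation for z^nu. *)
Definition chain_of_family (R : realType) (m : R[i] -> R[i])
    (U : set R[i]^o) (X : dm_extension m U) (h : nat -> U -> R[i]^o) p :
    amb X :=
  if p is q.+1 then of_fun X (h q.+1) else 0.

Lemma chain_of_familyP (R : realType) (m : R[i] -> R[i])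
    (U : set R[i]^o) (X : dm_extension m U) nu h p :
  dm_exponent m nu -> H_family X (m nu / m (nu - 1)) nu h ->
  let w := chain_of_family X h in
  ext_z X (ext_d X (w p.+1)) = (m nu / m (nu - 1)) *: w p.+1 + w p.
Proof.
move=> hnu [_ h1 _ dh] /=; case: p => [|p].
  have dmon := dm_dom_monomial 1 hnu; rewrite scale1r in dmon.
  have := zmul_dm_monomial m nu 1; rewrite scale1r => zdmon.
  rewrite h1 -/(monomial nu) ext_d_series// ext_z_series zdmon.
  by rewrite linearZ addr0.
have [g -> zg] := dh p.+1 isT.
rewrite ext_z_fun -linearZ -linearD; congr (of_fun X _).
by apply/funext => u; rewrite zg.
Qed.

Lemma symbolic_solution_convolution (R : realType) (m : R[i] -> R[i])
    (U : set R[i]^o) (X : dm_extension m U) n nk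
    (B : 'M[R[i]]_n) (V : 'M[R[i]]_(n, nk)) nu h (j : 'I_nk) :
  dm_exponent m nu -> H_family X (m nu / m (nu - 1)) nu h ->
  B *m V = V *m jordan_block nk (m nu / m (nu - 1)) ->
  symbolic_solution B
    (\col_r \sum_i V r i *: chain_of_family X h (j.+1 - i)%N).
Proof.
move=> hnu hfam BV.
apply: (jordan_convolution_solves j _ _ BV) => //.
- by move=> c x y; exact: ext_dom_linear.
- by move=> c x y; exact: ext_d_linear.
- by move=> p; case: hfam => _ _ + _; exact.
- by move=> p; exact: chain_of_familyP.
Qed.

(** The terms i > j vanish because the truncated subtraction j + 1 - i
    selects w_0 = 0. *)
Lemma fun_col_convolution (R : realType) (m : R[i] -> R[i])
    (U : set R[i]^o) (X : dm_extension m U) n nk (V : 'M[R[i]]_(n, nk)) h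
    (j : 'I_nk) :
  fun_col X (fun u => \sum_(i < nk | (i <= j)%N) h (j - i).+1 u *: col i V) =
  \col_r \sum_i V r i *: chain_of_family X h (j.+1 - i)%N.
Proof.
apply/matrixP => r c; rewrite !mxE.
rewrite [RHS](bigID (fun i : 'I_nk => (i <= j)%N)) /= addrC big1 ?add0r.
  transitivity
      (of_fun X (\sum_(i < nk | (i <= j)%N) V r i *: h (j - i).+1)).
    congr (of_fun X _); apply/funext => u; rewrite summxE fct_sumE.
    by apply: eq_bigr => i _; rewrite !mxE mulrC.
  rewrite linear_sum; apply: eq_bigr => i leij.
  by rewrite linearZ subSn.
move=> i; rewrite -ltnNge => ltji.
have /eqP-> : (j.+1 - i)%N == 0%N by rewrite subn_eq0.
exact: scaler0.
Qed.

(** The first column of a symbolic block is given as a formal series, but the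
    identification of the formal z^nu with H_1 makes it the convolution for
    j = 0. *)
Lemma series_col_convolution (R : realType) (m : R[i] -> R[i])
    (U : set R[i]^o) (X : dm_extension m U) n nk (V : 'M[R[i]]_(n, nk)) mu nu
    h (nk_gt0 : (0 < nk)%N) :
  H_family X mu nu h ->
  series_col X (zmonomial_col nu (col (Ordinal nk_gt0) V)) =
  \col_r \sum_i V r i *: chain_of_family X h (1 - i)%N.
Proof.
move=> [_ h1 _ _]; apply/matrixP => r c; rewrite [LHS]mxE zmonomial_colE !mxE.
rewrite (bigD1 (Ordinal nk_gt0))//= h1 linearZ big1 ?addr0// => i ni.
have /eqP-> : (1 - i)%N == 0%N by rewrite subn_eq0 lt0n.
exact: scaler0.
Qed.

Theorem theorem4p1 (R : realType) (m : R[i] -> R[i])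
  (m_pos : forall p : nat, 0 < m p%:R)
  (s : nat) (nk : 'I_s -> nat) (nk_gt0 : forall k, (0 < nk k)%N)
  (mu mut : 'I_s -> R[i])
  (B P : 'M[R[i]]_(\sum_k nk k))
  (P_unit : P \in unitmx)
  (B_jordan :
     B = P *m (\mxdiag_k jordan_block (nk k) (mu k)) *m invmx P)
  (mut_ge1 : forall k, 1 <= complex.Re (mut k))
  (m_neq0 : forall k (p : nat), m (mut k + p%:R - 1) != 0)
  (mu_mut : forall k, mu k = m (mut k) / m (mut k - 1))
  (nonresonant : forall (k1 k2 : 'I_s) (l : nat), k1 != k2 -> (0 < l)%N ->
     mu k1 != m (mut k2 + l%:R) / m (mut k2 + l%:R - 1)) :
  exists C : 'I_s -> 'cV[fseries R]_(\sum_k nk k),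
    (forall k, [/\ is_floquet (C k), formal_solution m B (C k) &
       C k = zmonomial_col (mut k) (jcol P (Ordinal (nk_gt0 k)))]) /\
    forall (U : set R[i]^o) (X : dm_extension m U)
      (H : 'I_s -> nat -> U -> R[i]^o),
      open U -> connected U -> closure U 0 ->
      (forall k, H_family X (mu k) (mut k) (H k)) ->
      exists D : forall k, 'I_(nk k) -> U -> 'cV[R[i]]_(\sum_k nk k),
        (forall k (j : 'I_(nk k)), (0 < j)%N ->
           symbolic_solution B (fun_col X (D k j)) /\
           forall u, D k j u =
             \sum_(i < nk k | (i <= j)%N) H k (j - i).+1 u *: jcol P i) /\
        symbolic_solution_mx B (\mxrow_k symbolic_block X (C k) (@D k)).
Proof.
have expo k : dm_exponent m (mut k) by split.
have BV k : B *m submxrow P k =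
    submxrow P k *m jordan_block (nk k) (m (mut k) / m (mut k - 1)).
  by rewrite -mu_mut (mul_submxrow_jordan k P_unit B_jordan).
exists (fun k => zmonomial_col (mut k) (jcol P (Ordinal (nk_gt0 k)))).
split=> [k|U X H _ _ _ HH].
  split=> //; first by apply: is_floquet_zmonomial; exact: jcol_neq0.
  apply: formal_solution_eigenvector => //.
  by rewrite jcolE colE mulmxA BV -!colE col_mul_jordan_block.
exists (fun k j u => \sum_(i < nk k | (i <= j)%N) H k (j - i).+1 u *: jcol P i).
have hfam k : H_family X (m (mut k) / m (mut k - 1)) (mut k) (H k).
  by rewrite -mu_mut.
have funE k (j : 'I_(nk k)) :
    fun_col X (fun u => \sum_(i < nk k | (i <= j)%N)
      H k (j - i).+1 u *: jcol P i) =
    \col_r \sum_i submxrow P k r i *: chain_of_family X (H k) (j.+1 - i)%N.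
  rewrite -fun_col_convolution; congr fun_col; apply/funext => u.
  by apply: eq_bigr => i _; rewrite jcolE.
have sol k j := symbolic_solution_convolution j (expo k) (hfam k) (BV k).
split=> [k j _|c].
  by split=> //; rewrite funE.
set k := tagnat.sig1 c; set j := tagnat.sig2 c.
rewrite [col c _](_ : _ = \col_r \sum_i submxrow P k r i *:
  chain_of_family X (H k) (j.+1 - i)%N); first exact: sol.
apply/matrixP => r c'; rewrite mxE mxE [LHS]mxE [LHS]mxE -/k -/j.
have [j0|_] := eqVneq (j : nat) 0%N; last by rewrite funE mxE.
by rewrite jcolE (series_col_convolution _ (nk_gt0 k) (hfam k)) mxE j0.
Qed.
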